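(* For every integer $n\ge 1$ there exists a constant $C_n>0$ such that for every $r>0$ $$N_n(r)\ \ge\ C_n\, r^{\log_2(n)},$$ where $$N_n(r):=\min\Big\{\,\big|\operatorname{supp}(u)\cap[-r,r]^n\big| \ :\ u:\mathbb{Z}^n\to\mathbb{Z}_2 \text{ harmonic},\ u(0)=1\Big\}.$$
   Context: $\mathbb{Z}_2=\mathbb{Z}/2\mathbb{Z}$, $e_1,\dots,e_n$ are the standard basis vectors of $\mathbb{Z}^n$, and $\operatorname{supp}(u)=\{x\in\mathbb{Z}^n:u(x)\neq 0\}$. A function $u:\mathbb{Z}^n\to\mathbb{Z}_2$ is harmonic if $\sum_{i=1}^n\big(u(x+e_i)+u(x-e_i)\big)=0$ in $\mathbb{Z}_2$ for all $x\in\mathbb{Z}^n$. *)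

(* Defs.v *)
From mathcomp Require Import all_boot all_order all_algebra finmap.
From mathcomp Require Import all_classical all_reals all_analysis.

Set Implicit Arguments.
Unset Strict Implicit.
Unset Printing Implicit Defensive.

Import Order.TTheory GRing.Theory Num.Theory.

Local Open Scope classical_set_scope.
Local Open Scope ring_scope.

Definition std_basis (n : nat) (i : 'I_n) : 'rV[int]_n := delta_mx 0 i.

Definition harmonic (n : nat) (u : 'rV[int]_n -> 'Z_2) : Prop :=
  forall x : 'rV[int]_n,
    \sum_(i < n) (u (x + std_basis i) + u (x - std_basis i)) = 0.

Definition supp (n : nat) (u : 'rV[int]_n -> 'Z_2) : set 'rV[int]_n :=
  [set x | u x != 0].

Definition cube (R : realType) (n : nat) (r : R) : set 'rV[int]_n :=
  [set x | forall i : 'I_n, (x 0 i)%:~R \in `[- r, r]].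
Arguments cube {R} n r.

(* [fset_set] is [fset0] on infinite sets; by this lemma that case never
   arises for subsets of a cube. *)
Lemma finite_cube (R : realType) (n : nat) (r : R) : finite_set (cube n r).
Proof.
pose m := `|Num.floor `|r| |%N.
pose g (f : {ffun 'I_n -> 'I_(m + m).+1}) : 'rV[int]_n :=
  \row_i ((f i : nat)%:Z - m%:Z).
apply: (@sub_finite_set _ _ (g @` setT)); last exact/finite_image/finite_finset.
move=> x xr /=.
have hm : m%:Z = Num.floor `|r|.
  by rewrite /m gez0_abs// floor_ge0.
have bound i : `|x 0 i| <= m%:Z.
  rewrite hm floor_ge_int intr_norm.
  have := xr i; rewrite in_itv /= -ler_norml => h.
  exact: le_trans h (ler_norm _).
exists [ffun i : 'I_n => inord (absz (x 0%R i + m%:Z)%R)] => //.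
apply/rowP => i; rewrite !mxE ffunE.
have := bound i; rewrite ler_norml => /andP[h1 h2].
have h0 : 0 <= x 0 i + m%:Z by rewrite -lerBlDr sub0r.
rewrite inordK; first by rewrite gez0_abs// addrK.
by rewrite ltnS -lez_nat gez0_abs// PoszD lerD2r.
Qed.

Definition supp_count (R : realType) (n : nat) (r : R)
    (u : 'rV[int]_n -> 'Z_2) : nat :=
  #|` fset_set (supp u `&` cube n r)|.

Definition attained (R : realType) (n : nat) (r : R) : pred nat :=
  fun k => `[< exists u : 'rV[int]_n -> 'Z_2,
    [/\ harmonic u, u 0 = 1 & supp_count r u = k] >].

Lemma attained_nonempty (R : realType) (n : nat) (r : R) :
  exists k, attained n r k.
Proof.
exists (supp_count r (fun _ : 'rV[int]_n => 1)).
apply/asboolP; exists (fun=> 1); split=> // x.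
by apply: big1 => i _; apply/val_inj.
Qed.

Definition N (R : realType) (n : nat) (r : R) : nat :=
  ex_minn (attained_nonempty n r).

Definition log2 (R : realType) (x : R) : R := ln x / ln 2.

(* Main.v *)
Require Import Defs.
From mathcomp Require Import all_boot all_order all_algebra.
From mathcomp Require Import all_classical all_reals all_analysis.
From mathcomp Require Import finmap zify.

Import Order.TTheory GRing.Theory Num.Theory.
Local Open Scope ring_scope.

Set Implicit Arguments.
Unset Strict Implicit.
Unset Printing Implicit Defensive.

(** In characteristic 2 the neighbour sum is a Laurent polynomial whose square
    is the same polynomial in the squares of the variables. Hence a harmonic
    function stays harmonic on every translate of the sublattice [2 ^ j Z^n]
    ([harmonic_on_rescale]), and points of the support found at small scale can
    be multiplied: if [n ^ j] of them, pairwise incongruent modulo [2 ^ j],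
    always lie within a bounded distance of a given one, then the same holds
    inside each of their residue classes, and so on ([hits_refine]). After scale
    [2 ^ m] this gives about [n ^ m] points at distance [O(2 ^ m)], which is the
    exponent [log2 n].

    With [j = 1] this asks for [n] parity classes meeting the support. When
    there are fewer, a pigeonhole argument gives a nonempty proper set [A] of
    directions such that the sum of the coordinates in [A] is even at all nearby
    points of the support ([parity_constant]). The neighbours of a point in the directions of
    [A] and those in the other directions then have opposite parities, so one of
    the two kinds contributes nothing, and the function is harmonic separately
    in the directions of [A] and in those of its complement [B]
    ([harmonic_on_split]). Points found in the two complementary sublattices
    multiply ([hits_prod]), so by induction on the number of directions the
    counts behave like [(#|A| * #|B|) ^ m].

    If both parts have at least two directions, [#|A| * #|B| >= #|A| + #|B|].
    If [A] is a single direction, the function has period 2 along it, which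
    contributes a factor of about [2 ^ m], and [2 * (n - 1)] (or 4, when
    [n = 2]) exceeds [n].

    The delicate point is that constant factors must not accumulate along the
    iteration. Therefore the induction carries two statements: [growth_at],
    where constants may be lost, and [branching], where in a bounded window
    either the parity classes suffice or some scale [j] yields [C * n ^ j] points
    with [C] prescribed. The surplus [C] pays for the constants lost in the
    complementary factor ([branching_step]), and [branching] with [C = 1]
    iterates without loss ([growth_of_branching]). *)

(** * Boxes in coordinate sublattices, local harmonicity, incongruent points *)

(** The factor [i \in J] forces the coordinates outside [J] to vanish, so this is
    the box of the sublattice spanned by the directions in [J]. *)
Definition box (n : nat) (J : {set 'I_n}) (R : nat) (x : 'rV[int]_n) : Prop :=
  forall i : 'I_n, (`|x 0%R i| <= (i \in J) * R)%N.

(** Two sets of directions are needed because a function harmonic in the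
    directions [J] may turn out to be harmonic, at the points of the sublattice
    of [J], in the directions of a subset [A] alone. *)
Definition harmonic_on (n : nat) (J A : {set 'I_n}) (R : nat)
    (u : 'rV[int]_n -> 'Z_2) : Prop :=
  forall x, box J R x ->
    \sum_(i in A) (u (x + std_basis i) + u (x - std_basis i)) = 0.

Definition cong (n m : nat) (x y : 'rV[int]_n) : Prop :=
  exists z : 'rV[int]_n, x - y = z *+ 2 ^ m.

(** Distinct residues modulo [2 ^ m], rather than mere distinctness, keep the
    points apart when each of them is replaced by points of its own residue
    class. *)
Definition hits (n : nat) (J : {set 'I_n}) (R m N : nat)
    (u : 'rV[int]_n -> 'Z_2) : Prop :=
  exists s : seq 'rV[int]_n,
    [/\ uniq s, (N <= size s)%N,
        forall x, x \in s -> box J R x /\ u x != 0 &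
        {in s &, forall x y, cong m x y -> x = y}].

Lemma box0 (n : nat) (J : {set 'I_n}) (R : nat) : box J R 0.
Proof. by move=> i; rewrite mxE. Qed.

Lemma boxW (n : nat) (A J : {set 'I_n}) (r R : nat) (x : 'rV[int]_n) :
  A \subset J -> (r <= R)%N -> box A r x -> box J R x.
Proof.
move=> /fintype.subsetP AJ rR bx i; apply: leq_trans (bx i) _.
apply: leq_mul => //; case: (boolP (i \in A)) => // /AJ -> //.
Qed.

Lemma boxD (n : nat) (J : {set 'I_n}) (r s : nat) (x y : 'rV[int]_n) :
  box J r x -> box J s y -> box J (r + s) (x + y).
Proof.
move=> bx bhy i; rewrite mxE mulnDr.
move: (bx i) (bhy i); move: (x _ _) (y _ _) (_ * r)%N (_ * s)%N => a b c d; lia.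
Qed.

Lemma boxMn (n : nat) (J : {set 'I_n}) (r c : nat) (x : 'rV[int]_n) :
  box J r x -> box J (c * r) (x *+ c).
Proof.
move=> bx i; rewrite mulmxnE -mulr_natr abszM natz absz_nat mulnCA mulnC.
by rewrite leq_mul2l bx orbT.
Qed.

Lemma box_basis (n : nat) (J : {set 'I_n}) (i : 'I_n) : i \in J ->
  box J 1 (std_basis i) /\ box J 1 (- std_basis i).
Proof.
move=> iJ; split=> j; rewrite !mxE /= ?abszN; case: eqP => [->|] //=;
by rewrite iJ.
Qed.

Lemma harmonic_onW (n : nat) (J A : {set 'I_n}) (r R : nat) u :
  (r <= R)%N -> harmonic_on J A R u -> harmonic_on J A r u.
Proof. by move=> rR h x bx; apply: h; apply: boxW bx. Qed.

Lemma hitsW (n : nat) (A J : {set 'I_n}) (r R m N M : nat) u :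
  A \subset J -> (r <= R)%N -> (N <= M)%N -> hits A r m M u -> hits J R m N u.
Proof.
move=> AJ rR NM [s [us sz hs hc]]; exists s; split=> //; first exact: leq_trans sz.
by move=> x /hs[bx ux]; split=> //; apply: boxW bx.
Qed.

Lemma harmonic_on_translate (n : nat) (J A : {set 'I_n}) (r s R : nat) u p :
  A \subset J -> box J r p -> (r + s <= R)%N ->
  harmonic_on J A R u -> harmonic_on A A s (fun y => u (p + y)).
Proof.
move=> AJ bp rs h x bx.
have /h : box J R (p + x).
  apply: boxW rs _ => //; apply: boxD => //; exact: boxW bx.
by under eq_bigr do rewrite -!addrA.
Qed.

(** * Harmonicity at all dyadic scales *)

Lemma addZ2 (a : 'Z_2) : a + a = 0.
Proof. by case: a => [[|[|]]] //= H; apply/val_inj. Qed.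

(** The neighbour sum applied twice is a double sum over pairs of signed
    directions. Pairs with two different entries, opposite ones included, occur in
    both orders and lead to the same point, so modulo 2 only the steps [e + e]
    survive. *)
Lemma harmonic_on_double (n : nat) (J : {set 'I_n}) (r R : nat) u :
  (r.*2 < R)%N -> harmonic_on J J R u ->
  harmonic_on J J r (fun y => u (y *+ 2)).
Proof.
move=> rR h x bx.
pose F i j := u (x *+ 2 + std_basis i + std_basis j).
pose G i j := u (x *+ 2 + std_basis i - std_basis j).
pose G' i j := u (x *+ 2 - std_basis i + std_basis j).
pose H i j := u (x *+ 2 - std_basis i - std_basis j).
have b2 : box J (r.*2) (x *+ 2) by rewrite -mul2n; apply: boxMn.
have eq0 : \sum_(i in J) \sum_(j in J) ((F i j + G i j) + (G' i j + H i j)) = 0.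
  apply: big1 => i iJ; have [b b'] := box_basis iJ.
  rewrite big_split /= /F /G /G' /H h ?h ?addr0 //.
    by apply: boxW (boxD b2 b'); rewrite // addn1.
  by apply: boxW (boxD b2 b); rewrite // addn1.
have sym0 (K : 'I_n -> 'I_n -> 'Z_2) : (forall i j, K i j = K j i) ->
    \sum_(i in J) \sum_(j in J) K i j = \sum_(i in J) K i i.
  move=> Ks.
  (* Off the diagonal the terms cancel in pairs (i, j), (j, i). *)
  have split3 i j : K i j = (if (i < j)%N then K i j else 0) +
      ((if (j < i)%N then K j i else 0) + (if i == j then K i i else 0)).
    rewrite -val_eqE; case: ltngtP => [_|_|/val_inj->] /=.
    - by rewrite !addr0.
    - by rewrite add0r addr0.
    - by rewrite !add0r.
  under eq_bigr do under eq_bigr do rewrite split3.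
  under eq_bigr do rewrite !big_split /=.
  rewrite !big_split /= [X in X + (_ + _)]exchange_big /= addrA addZ2 add0r.
  apply: eq_bigr => i iJ; rewrite (bigD1 i) //= eqxx big1 ?addr0 //.
  by move=> j /andP[_ /negPf]; rewrite eq_sym => ->.
have GG' : \sum_(i in J) \sum_(j in J) G i j = \sum_(i in J) \sum_(j in J) G' i j.
  rewrite exchange_big; apply: eq_bigr => j _; apply: eq_bigr => i _.
  by rewrite /G /G' addrAC.
move: eq0; under eq_bigr do rewrite !big_split /=.
rewrite !big_split /= -addrA GG' (addrA _ _ (\sum_(i in J) \sum_(j in J) H i j)).
rewrite addZ2 add0r.
rewrite !sym0 => [|i j|i j]; [|by rewrite /F addrAC|by rewrite /H addrAC].
rewrite -big_split /= => eqF; rewrite -[RHS]eqF -big_split; apply: eq_bigr => i _.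
by rewrite !mulrnDl mulNrn /F /H !mulr2n opprD !addrA.
Qed.

Lemma harmonic_on_dilate (n : nat) (J : {set 'I_n}) (j r : nat) u :
  harmonic_on J J (2 ^ j * r.+1) u ->
  harmonic_on J J r (fun y => u (y *+ 2 ^ j)).
Proof.
(* Doubling maps the radius [r] to [2 * r + 1], whose [j]-th iterate is
   [2 ^ j * (r + 1) - 1]. *)
move=> h; have {h} : harmonic_on J J (2 ^ j * r.+1).-1 u.
  by apply: harmonic_onW h; rewrite leq_pred.
elim: j u => [|j IH] u h.
  by move=> x bx; move: (h x); rewrite expn0 mul1n; apply.
have := IH (fun y => u (y *+ 2)); rewrite /= => IH'.
have -> : (fun y => u (y *+ 2 ^ j.+1)) = (fun y => u (y *+ 2 ^ j *+ 2)).
  by apply/funext => y; rewrite -mulrnA expnS mulnC.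
apply: IH'; apply: harmonic_on_double h.
have : (0 < 2 ^ j * r.+1)%N by rewrite muln_gt0 expn_gt0.
by rewrite expnS -mulnA; lia.
Qed.

Lemma harmonic_on_rescale (n : nat) (J : {set 'I_n}) (j r s R : nat) u p :
  box J r p -> (r + 2 ^ j * s.+1 <= R)%N -> harmonic_on J J R u ->
  harmonic_on J J s (fun y => u (p + y *+ 2 ^ j)).
Proof.
move=> bp rsR h; apply: (@harmonic_on_dilate _ _ _ _ (fun y => u (p + y))).
exact: harmonic_on_translate h.
Qed.

(** * Combining families of incongruent points *)

Lemma hits_pt (n : nat) (J : {set 'I_n}) (R m : nat) u :
  u 0 != 0 -> hits J R m 1 u.
Proof.
move=> u0; exists [:: 0]; split=> // [x|x y]; rewrite !inE => /eqP->.
  by split=> //; apply: box0.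
by move=> /eqP->.
Qed.

Lemma hits_translate (n : nat) (J : {set 'I_n}) (r R m N : nat) u p :
  box J r p -> hits J R m N (fun y => u (p + y)) -> hits J (r + R) m N u.
Proof.
move=> bp [s [us sz hs hc]]; exists (map (+%R p) s); split.
- by rewrite map_inj_uniq //; apply: addrI.
- by rewrite size_map.
- by move=> _ /mapP[x /hs[bx ux] ->]; split=> //; apply: boxD.
- move=> _ _ /mapP[x xs ->] /mapP[y ys ->] [z e]; congr (p + _).
  by apply: hc => //; exists z; rewrite -e opprD addrACA subrr add0r.
Qed.

(** Common form of the two ways of multiplying counts used below: the family
    around each point [x] of a first family is scaled by [c], with [c = 2 ^ j]
    for refinement inside residue classes and [c = 1] for complementary
    sublattices. The last two hypotheses say that the residue of [x + y *+ c]
    determines the residue of [x], and that of [y *+ c] the residue of [y]. *)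
Lemma hits_bind (n : nat) (J1 J2 J : {set 'I_n}) (R1 R2 R m1 m2 m N1 N2 c : nat)
    u v :
  hits J1 R1 m1 N1 u ->
  (forall x, box J1 R1 x -> u x != 0 ->
     hits J2 R2 m2 N2 (fun y => v (x + y *+ c))) ->
  (forall x y, box J1 R1 x -> box J2 R2 y -> box J R (x + y *+ c)) ->
  (forall x x' y y', box J1 R1 x -> box J1 R1 x' -> box J2 R2 y ->
     box J2 R2 y' -> cong m (x + y *+ c) (x' + y' *+ c) -> cong m1 x x') ->
  (forall y y', box J2 R2 y -> box J2 R2 y' ->
     cong m (y *+ c) (y' *+ c) -> cong m2 y y') ->
  hits J R m (N1 * N2) v.
Proof.
move=> [s [us sz hs hc]] hv hbox hc1 hc2.
pose ok x t := x \in s -> [/\ uniq t, (N2 <= size t)%N,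
  forall y, y \in t -> box J2 R2 y /\ v (x + y *+ c) != 0 &
  {in t &, forall y y', cong m2 y y' -> y = y'}].
have [t tP] : {t & forall x, ok x (t x)}.
  apply: choice => x; case: (boolP (x \in s)) => [xs|/negP nxs].
    by have [bx ux] := hs _ xs; have [t ?] := hv _ bx ux; exists t.
  by exists [::] => /nxs.
have inj x x' y y' : x \in s -> x' \in s -> y \in t x -> y' \in t x' ->
    cong m (x + y *+ c) (x' + y' *+ c) -> x = x' /\ y = y'.
  move=> xs x's yt y't e.
  have [[bx _] [bx' _]] := (hs _ xs, hs _ x's).
  have [_ _ tb tc] := tP _ xs; have [_ _ tb' _] := tP _ x's.
  have [[bhy _] [bhy' _]] := (tb _ yt, tb' _ y't).
  have xx' : x = x' by apply: hc => //; apply: hc1 e.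
  split=> //; subst x'; apply: tc => //; apply: hc2 => //.
  by case: e => z e; exists z; rewrite -e opprD addrACA subrr add0r.
have cong_refl x : cong m x x by exists 0; rewrite subrr mul0rn.
exists [seq x + y *+ c | x <- s, y <- t x]; split.
- apply: allpairs_uniq_dep => // [x xs|].
    by have [] := tP _ xs.
  move=> [x y] [x' y'] /allpairsPdep[a [b [xs yt e]]].
  move=> /allpairsPdep[a' [b' [xs' yt' e']]] /=.
  case: e e' xs yt xs' yt' => -> -> [-> ->] xs yt xs' yt' e.
  have [] := inj _ _ _ _ xs xs' yt yt'; first by rewrite e.
  by move=> -> ->.
- rewrite size_allpairs_dep sumnE big_map.
  apply: leq_trans (_ : size s * N2 <= _)%N; first exact: leq_mul.
  rewrite mulnC -sum1_size big_distrr /= big_seq [leqRHS]big_seq.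
  by apply: leq_sum => x xs; rewrite muln1; have [] := tP _ xs.
- move=> _ /allpairsPdep[x [y [xs yt ->]]].
  have [_ _ tb _] := tP _ xs; have [bhy vy] := tb _ yt.
  by split=> //; apply: hbox => //; case: (hs _ xs).
- move=> _ _ /allpairsPdep[x [y [xs yt ->]]] /allpairsPdep[x' [y' [xs' yt' ->]]].
  by move=> /(inj _ _ _ _ xs xs' yt yt')[-> ->].
Qed.

Lemma rV_mulrnI (n c : nat) (x y : 'rV[int]_n) :
  (0 < c)%N -> x *+ c = y *+ c -> x = y.
Proof.
move=> c0 /rowP e; apply/rowP => i; have := e i; rewrite !mulmxnE.
exact: pmulrnI.
Qed.

Lemma hits_refine (n : nat) (J : {set 'I_n}) (R1 R2 j m N1 N2 : nat) u :
  (j <= m)%N ->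
  hits J R1 j N1 u ->
  (forall x, box J R1 x -> u x != 0 ->
     hits J R2 (m - j) N2 (fun y => u (x + y *+ 2 ^ j))) ->
  hits J (R1 + 2 ^ j * R2) m (N1 * N2) u.
Proof.
move=> jm h1 h2.
have pow z : z *+ 2 ^ m = z *+ 2 ^ (m - j) *+ 2 ^ j :> 'rV[int]_n.
  by rewrite -mulrnA -expnD subnK.
apply: (hits_bind h1 h2).
- by move=> x y bx bhy; apply: boxD => //; apply: boxMn.
- move=> x x' y y' _ _ _ _ [z e]; exists (z *+ 2 ^ (m - j) - (y - y')).
  by rewrite mulrnBl -pow -e mulrnBl opprD addrACA addrK.
- move=> y y' _ _ [z e]; exists z; apply: (@rV_mulrnI _ (2 ^ j)).
    by rewrite expn_gt0.
  by rewrite -pow -e mulrnBl.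
Qed.

Lemma hits_prod (n : nat) (A B J : {set 'I_n}) (R1 R2 m N1 N2 : nat) u :
  A \subset J -> B \subset J -> [disjoint A & B] ->
  hits A R1 m N1 u ->
  (forall x, box A R1 x -> u x != 0 -> hits B R2 m N2 (fun y => u (x + y))) ->
  hits J (R1 + R2) m (N1 * N2) u.
Proof.
move=> AJ BJ dAB h1 h2.
apply: (@hits_bind _ _ _ _ _ _ _ _ _ _ _ _ 1 _ _ h1 h2).
- by move=> x y bx bhy; apply: boxD; [exact: boxW bx|exact: boxW bhy].
- move=> x x' y y' bx bx' bhy bhy' [z e].
  (* Projecting to the coordinates in [A] removes [y] and [y']. *)
  exists (\row_i (if i \in A then z 0 i else 0)).
  apply/rowP => i; move: (congr1 (fun M : 'rV_n => M 0 i) e).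
  have := (bx i, bx' i, bhy i, bhy' i).
  rewrite !mulmxnE !mxE !mulr1n; case: ifP => iA.
    have -> : (i \in B) = false by apply: (disjointFr dAB).
    rewrite /= mul0n !leqn0 !absz_eq0 => -[[_ /eqP->] /eqP->].
    by rewrite !addr0.
  by rewrite /= mul0n !leqn0 !absz_eq0 => -[[[/eqP-> /eqP->] _] _]; rewrite subrr mul0rn.
- by [].
Qed.

(** * Splitting the set of directions by parity *)

Definition parity (n : nat) (A : {set 'I_n}) (t : 'rV['Z_2]_n) : 'Z_2 :=
  \sum_(i in A) t 0 i.

Definition reduce (n : nat) (x : 'rV[int]_n) : 'rV['Z_2]_n :=
  map_mx intr x.

Lemma reduce_cong (n : nat) (x y : 'rV[int]_n) :
  cong 1 x y -> reduce x = reduce y.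
Proof.
move=> [z e]; apply/eqP; rewrite -subr_eq0 /reduce -map_mxB e.
by apply/eqP/rowP => i; rewrite mxE mulmxnE mulr2n raddfD addZ2 mxE.
Qed.

Lemma parity_reduceD (n : nat) (A : {set 'I_n}) (x y : 'rV[int]_n) :
  parity A (reduce (x + y)) = parity A (reduce x) + parity A (reduce y).
Proof.
by rewrite /parity -big_split /=; apply: eq_bigr => i _; rewrite !mxE intrD.
Qed.

Lemma Z2_neq0 (a : 'Z_2) : a != 0 -> a = 1.
Proof. by case: a => [[|[|]]] //= H _; apply/val_inj. Qed.

Lemma oppZ2 (a : 'Z_2) : - a = a.
Proof. by case: a => [[|[|]]] //= H; apply/val_inj. Qed.

Lemma parity_basis (n : nat) (A : {set 'I_n}) (i : 'I_n) :
  parity A (reduce (std_basis i)) = (i \in A)%:R.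
Proof.
rewrite /parity; case: (boolP (i \in A)) => iA.
  rewrite (bigD1 i) //= !mxE !eqxx big1 ?addr0 // => j /andP[_ /negPf ji].
  by rewrite !mxE ji andbF.
rewrite big1 // => j jA; rewrite !mxE.
have /negPf-> : j != i by apply: contraTneq jA => ->.
by rewrite andbF.
Qed.

Lemma parity_basisN (n : nat) (A : {set 'I_n}) (i : 'I_n) :
  parity A (reduce (- std_basis i)) = (i \in A)%:R.
Proof.
rewrite -[RHS]oppZ2 -parity_basis /parity -sumrN.
by apply: eq_bigr => j _; rewrite !mxE intrN.
Qed.

(** The subsets [D] of [J] without a fixed element number [2 ^ (#|J| - 1)], and
    each singles out the parity classes of the support, other than that of the
    origin, on which its coordinate sum is odd. Fewer than [#|J|] classes leave fewer than
    [2 ^ (#|J| - 1)] outcomes, so two subsets agree on the whole support, and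
    their symmetric difference has even sum there. *)
Lemma parity_constant (n : nat) (J : {set 'I_n}) (R : nat) u :
  (0 < #|J|)%N -> u 0 != 0 -> ~ hits J R 1 #|J| u ->
  exists A : {set 'I_n}, [/\ A \subset J, (0 < #|A| < #|J|)%N &
    forall x, box J R x -> u x != 0 -> parity A (reduce x) = 0].
Proof.
move=> J0 u0 nh.
pose rep t x := [/\ box J R x, u x != 0 & reduce x = t].
pose T := [set t : 'rV['Z_2]_n | `[< exists x, rep t x >]].
have T0 : 0 \in T.
  rewrite inE; apply/asboolP; exists 0; split=> //; first exact: box0.
  by rewrite /reduce map_mx0.
have [JT|TJ] := leqP #|J| #|T|.
  pose ok t x := t \in T -> rep t x.
  have [f fP] : {f & forall t, ok t (f t)}.
    apply: choice => t; case: (boolP (t \in T)) => [|/negP nt].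
      by rewrite inE => /asboolP[x hx]; exists x.
    by exists 0 => /nt.
  case: nh; exists (map f (enum T)); split.
  - rewrite map_inj_in_uniq ?enum_uniq // => t t'; rewrite !mem_enum.
    by move=> /fP[_ _ e] /fP[_ _ e'] ff; rewrite -[LHS]e -[RHS]e' ff.
  - by rewrite size_map -cardE.
  - by move=> _ /mapP[t + ->]; rewrite mem_enum => /fP[bx ux _].
  - move=> _ _ /mapP[t + ->] /mapP[t' + ->]; rewrite !mem_enum.
    by move=> /fP[_ _ e] /fP[_ _ e'] /reduce_cong; rewrite e e' => ->.
(* Leaving out [i0] makes the set found below a proper subset of [J]. The class
   of the origin can be left out of [T] because all its sums vanish. *)
have [i0 i0J] : exists i0, i0 \in J by apply/card_gt0P.
pose F (D : {set 'I_n}) := [set t in T | parity D t != 0].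
have sub : F @: powerset (J :\ i0) \subset powerset (T :\ 0).
  apply/fintype.subsetP => _ /imsetP[D _ ->]; rewrite powersetE.
  apply/fintype.subsetP => t; rewrite !inE => /andP[-> +]; rewrite andbT.
  by apply: contra_neq => ->; rewrite /parity big1 // => i _; rewrite mxE.
have ninj : ~~ [forall D in powerset (J :\ i0), forall D' in powerset (J :\ i0),
    (F D == F D') ==> (D == D')].
  apply/negP => /forall_inP inj; have := subset_leq_card sub.
  rewrite card_in_imset => [|D D' DJ D'J /eqP e].
    rewrite !card_powerset leq_exp2l // => le1.
    by move: TJ; rewrite (cardsD1 i0 J) (cardsD1 0 T) i0J T0 ltnNge !add1n ltnS le1.
  by have /forall_inP/(_ _ D'J)/implyP/(_ e)/eqP := inj _ DJ.
move: ninj; rewrite negb_forall_in => /exists_inP[D].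
rewrite powersetE => DJ; rewrite negb_forall_in => /exists_inP[D'].
rewrite powersetE => D'J; rewrite negb_imply => /andP[/eqP FDD' neD].
exists ((D :\: D') :|: (D' :\: D)).
have AJ : (D :\: D') :|: (D' :\: D) \subset J :\ i0.
  by rewrite finset.subUset !(fintype.subset_trans (finset.subsetDl _ _)).
split.
- by apply: fintype.subset_trans AJ _; apply: finset.subD1set.
- apply/andP; split; last first.
    by apply: leq_ltn_trans (subset_leq_card AJ) _; rewrite [ltnRHS](cardsD1 i0) i0J.
  rewrite lt0n cards_eq0; apply: contraNneq neD => A0.
  rewrite finset.eqEsubset -!finset.setD_eq0 -!finset.subset0 -A0.
  by rewrite finset.subsetUl finset.subsetUr.
- move=> x bx ux; pose t := reduce x.
  have tT : t \in T by rewrite inE; apply/asboolP; exists x.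
  have e : parity D t = parity D' t.
    have := congr1 (fun S : {set _} => t \in S) FDD'; rewrite !inE.
    have -> /= : `[< exists x0, rep t x0 >] by move: tT; rewrite inE.
    have [->|/Z2_neq0->] := eqVneq (parity D t) 0.
      by move=> /esym /negbFE/eqP->.
    by move=> /esym/Z2_neq0 ->.
  rewrite -/t /parity (big_setID D) /=.
  have -> : (D :\: D' :|: D' :\: D) :&: D = D :\: D'.
    by apply/setP => i; rewrite !inE; case: (i \in D); case: (i \in D').
  have -> : (D :\: D' :|: D' :\: D) :\: D = D' :\: D.
    by apply/setP => i; rewrite !inE; case: (i \in D); case: (i \in D').
  move: e; rewrite /parity (big_setID D') [RHS](big_setID D) /= finset.setIC.
  by move=> /addrI->; rewrite addZ2.
Qed.

(** At a point whose [A]-sum is even, a step in a direction of [A] leaves the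
    support; at a point whose [A]-sum is odd, a step in any other direction
    stays outside it. Either way one part of the neighbour sum vanishes, and
    therefore so does the other. *)
Lemma harmonic_on_split (n : nat) (J A : {set 'I_n}) (R : nat) u :
  A \subset J ->
  (forall x, box J R.+1 x -> u x != 0 -> parity A (reduce x) = 0) ->
  harmonic_on J J R.+1 u ->
  harmonic_on J A R u /\ harmonic_on J (J :\: A) R u.
Proof.
move=> AJ par h.
have nb x i : box J R x -> i \in J ->
    box J R.+1 (x + std_basis i) /\ box J R.+1 (x - std_basis i).
  by move=> bx /box_basis[b b']; rewrite -addn1; split; apply: boxD.
have h' x : box J R x ->
    \sum_(i in A) (u (x + std_basis i) + u (x - std_basis i)) +
    \sum_(i in J :\: A) (u (x + std_basis i) + u (x - std_basis i)) = 0.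
  move=> bx; rewrite -[RHS](h x); last exact: boxW bx.
  by rewrite [RHS](big_setID A) /= (finset.setIidPr AJ).
have hA : harmonic_on J A R u.
  move=> x bx.
  have vanish y : box J R.+1 y -> parity A (reduce y) != 0 -> u y = 0.
    by move=> bhy; apply: contraNeq => uy; rewrite par.
  have [p0|p1] := eqVneq (parity A (reduce x)) 0.
    apply: big1 => i iA; have [b b'] := nb _ i bx (fintype.subsetP AJ _ iA).
    by rewrite !vanish ?addr0 // parity_reduceD ?parity_basis ?parity_basisN p0 iA.
  rewrite -[RHS](h' x bx) [X in _ + X]big1 ?addr0 // => i; rewrite inE.
  move=> /andP[/negPf iA iJ]; have [b b'] := nb _ i bx iJ.
  by rewrite !vanish ?addr0 // parity_reduceD ?parity_basis ?parity_basisN iA addr0.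
by split=> // x bx; have := h' x bx; rewrite hA ?add0r.
Qed.

(** Harmonicity in one direction is 2-periodicity, so the even multiples of the
    basis vector all belong to the support. *)
Lemma hits_single (n : nat) (i : 'I_n) (m : nat) u :
  harmonic_on [set i] [set i] (2 ^ m) u -> u 0 != 0 ->
  hits [set i] (2 ^ m) m (2 ^ (m - 1)) u.
Proof.
move=> h u0; pose p (l : nat) : 'rV[int]_n := std_basis i *+ (2 * l).
case: m h => [|m] h; first exact: hits_pt.
rewrite subn1 /=.
have bp l : (l < 2 ^ m)%N -> box [set i] (2 ^ m.+1) (p l).
  move=> lm; apply: (@boxW _ _ _ (2 * l * 1)) => //.
    by rewrite muln1 expnS leq_mul2l ltnW.
  by apply/boxMn; case: (@box_basis _ [set i] i); rewrite ?inE.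
exists (map p (iota 0 (2 ^ m))).
have pinj l l' : (l < 2 ^ m)%N -> (l' < 2 ^ m)%N -> cong m.+1 (p l) (p l') -> l = l'.
  move=> lm l'm [z /(congr1 (fun M : 'rV_n => M 0 i))].
  rewrite mulmxnE !mxE !mulmxnE !mxE !eqxx /= => e.
  have {}e : (l%:Z - l'%:Z) = z 0%R i * (2 ^ m)%N%:Z.
    apply: (@pmulrnI int 2) => //; rewrite mulrnBl -!natz mulr_natr -!mulrnA.
    by rewrite !(mulnC _ 2%N) -expnS.
  move: (z 0%R i) (2 ^ m)%N lm l'm e => c P lP l'P e.
  have [c0|c0|c0] := ltgtP c 0; [nia|nia|]. by move: e; rewrite c0; lia.
split.
- rewrite map_inj_in_uniq ?iota_uniq // => l l'; rewrite !mem_iota !add0n /=.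
  by move=> lm l'm e; apply: pinj => //; exists 0; rewrite e subrr mul0rn.
- by rewrite size_map size_iota.
- move=> _ /mapP[l + ->]; rewrite mem_iota /= add0n => lm; split; first exact: bp.
  elim: l lm => [|l IH] lm; first by rewrite /p muln0 mulr0n.
  have := IH (ltnW lm); apply: contra_neq => ul.
  have := h (p l + std_basis i); rewrite big_set1 addrK.
  have -> : p l + std_basis i + std_basis i = p l.+1.
    by rewrite /p mulnS (mulrnDr _ 2) mulr2n -addrA addrC.
  rewrite ul add0r; apply.
  apply: (@boxW _ [set i] _ (2 * l * 1 + 1)) => //.
    by rewrite expnS; lia.
  apply: boxD; first apply: boxMn; by case: (@box_basis _ [set i] i); rewrite ?inE.
- move=> _ _ /mapP[l + ->] /mapP[l' + ->]; rewrite !mem_iota /= !add0n => lm l'm e.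
  by congr p; apply: pinj.
Qed.

(** * Growth by induction on the number of directions *)

(** The base is [maxn 2 #|J|] because one direction alone already doubles the count
    with the scale; the truncated exponent [m - k] absorbs a bounded factor. *)
Definition growth_at (n : nat) (J : {set 'I_n}) (k m L : nat) : Prop :=
  forall u, harmonic_on J J L u -> u 0 != 0 ->
    hits J (k * 2 ^ m) m (maxn 2 #|J| ^ (m - k)) u.

(** One step of the iteration: at least [#|J|] to the power [j] points modulo
    [2 ^ j], with a surplus factor [C] whenever the parity classes do not
    suffice. The single bound [K] serves as window, as bound on the scale and
    as radius of harmonicity, which makes the statement monotone in it. *)
Definition branching (n : nat) (J : {set 'I_n}) (C K : nat) : Prop :=
  forall u, harmonic_on J J K u -> u 0 != 0 ->
    hits J K 1 #|J| u \/
    exists j, (0 < j <= K)%N /\ hits J K j (C * #|J| ^ j) u.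

Lemma growth_atW (n : nat) (J : {set 'I_n}) (k k' m L L' : nat) :
  (k <= k')%N -> (L <= L')%N -> growth_at J k m L -> growth_at J k' m L'.
Proof.
move=> kk LL g u h u0; have := g u (harmonic_onW LL h) u0.
apply: hitsW => //; first by rewrite leq_mul2r kk orbT.
by rewrite leq_pexp2l ?leq_max // leq_sub2l.
Qed.

Lemma branchingW (n : nat) (J : {set 'I_n}) (C K K' : nat) :
  (K <= K')%N -> branching J C K -> branching J C K'.
Proof.
move=> KK b u h u0; case: (b u (harmonic_onW KK h) u0) => [h1|[j [jK hj]]].
  by left; apply: hitsW h1.
right; exists j; split; last exact: hitsW hj.
by case/andP: jK => -> /leq_trans ->.
Qed.

Lemma uniform_bound (I : finType) (Q : I -> nat -> Prop) :
  (forall i p q, (p <= q)%N -> Q i p -> Q i q) ->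
  (forall i, exists p, Q i p) -> exists p, forall i, Q i p.
Proof.
move=> mono /(@choice _ _ Q)[f fP]; exists (\max_i f i)%N => i.
by apply: mono (fP i); apply: leq_bigmax.
Qed.

(** The scale [j] of a step depends on the base point, but it is at most [K], so
    the iteration stops with at most [K] levels missing, and the loss occurs
    only once. *)
Lemma growth_of_branching (n : nat) (J : {set 'I_n}) (K : nat) :
  (1 < #|J|)%N -> (0 < K)%N -> branching J 1 K ->
  forall m, exists L, growth_at J K m L.
Proof.
move=> J1 K0 hK m.
(* The radius [r_m = K * (2 ^ m - 1)] satisfies [K + 2 ^ j * r_(m - j) <= r_m] for
   [j >= 1], and so is preserved by the recursion. *)
suff [L hL] : exists L, forall u, harmonic_on J J L u -> u 0 != 0 ->
    hits J (K * (2 ^ m - 1)) m (#|J| ^ (m - K)) u.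
  exists L => u h u0; rewrite (maxn_idPr J1); apply: hitsW (hL u h u0) => //.
  by rewrite leq_mul2l leq_subr orbT.
elim/ltn_ind: m => m IH.
have [mK|Km] := leqP m K.
  exists 0%N => u _ u0; have -> : (m - K = 0)%N by apply/eqP.
  exact: hits_pt.
have [L hL] : exists L, forall i : 'I_m, forall u, harmonic_on J J L u -> u 0 != 0 ->
    hits J (K * (2 ^ i - 1)) i (#|J| ^ (i - K)) u.
  apply: uniform_bound => [i p q pq h u /(harmonic_onW pq)|i]; first exact: h.
  exact: IH.
exists (K + 2 ^ K * L.+1)%N => u h u0.
have [j [/andP[j0 jK] hj]] : exists j, (0 < j <= K)%N /\ hits J K j (#|J| ^ j) u.
  case: (hK u _ u0) => [||[j [jK]]].
  - exact: harmonic_onW (leq_addr _ _) h.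
  - by exists 1%N; rewrite expn1 K0.
  - by rewrite mul1n; exists j.
have jm : (j < m)%N by apply: leq_ltn_trans Km.
have mjm : (m - j < m)%N by rewrite ltn_subrL j0 (leq_trans _ jm).
apply: (@hitsW _ J _ (K + 2 ^ j * (K * (2 ^ (m - j) - 1))) _ _ _
          (#|J| ^ j * #|J| ^ (m - j - K))) => //.
- rewrite mulnCA (mulnBr (2 ^ j)%N) -expnD subnKC ?(ltnW jm) // muln1 -mulnS leq_mul2l.
  have : (2 ^ 1 <= 2 ^ j)%N by rewrite leq_exp2l.
  have : (2 ^ j <= 2 ^ m)%N by rewrite leq_exp2l // ltnW.
  by rewrite orbC; move: (2 ^ j)%N (2 ^ m)%N => p q; lia.
- by rewrite -expnD leq_pexp2l ?(ltnW J1) //; lia.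
apply: hits_refine => //; first exact: ltnW.
move=> x bx ux; apply: (hL (Ordinal mjm)).
  apply: (harmonic_on_rescale bx) h.
  by rewrite leq_add2l leq_mul2r leq_exp2l ?jK ?orbT.
by rewrite mul0rn addr0.
Qed.

(** With [b = maxn 2 (a - 1)] one has [2 * b >= 4 / 3 * a], so [(2 * b) ^ K]
    outgrows [a ^ K] by any prescribed factor. *)
Lemma expn_gap (a k C : nat) : (1 < a)%N ->
  exists2 K, (0 < K)%N &
    (C * a ^ K <= 2 ^ (K - k) * maxn 2 a.-1 ^ (K - k))%N.
Proof.
move=> a1; pose b := maxn 2 a.-1; pose D := (C * a ^ k)%N.
have ab : (4 * a <= 3 * (2 * b))%N by rewrite /b; case: leqP; lia.
(* Bernoulli's inequality for [4 / 3], cleared of denominators. *)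
have bern t : (3 ^ t * (t + 3) <= 3 * 4 ^ t)%N.
  elim: t => // t IH; rewrite !expnS; move: IH.
  by move: (3 ^ t)%N (4 ^ t)%N => p q; nia.
pose t := (3 * D).+1; exists (k + t)%N; first by rewrite /t addnS.
rewrite addKn -expnMn expnD mulnA -/D -/b.
have h4 : (3 ^ t * D <= 4 ^ t)%N.
  have := bern t; have : (3 ^ t * (3 * D) <= 3 ^ t * (t + 3))%N.
    by rewrite leq_mul2l /t; apply/orP; right; lia.
  by move: (3 ^ t)%N (4 ^ t)%N => p q; nia.
rewrite -(@leq_pmul2l (3 ^ t)) ?expn_gt0 // mulnA.
apply: leq_trans (_ : 4 ^ t * a ^ t <= _)%N; first by rewrite leq_mul2r h4 orbT.
by rewrite -!expnMn leq_exp2r.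
Qed.

(** If there are fewer than [#|J|] parity classes, split [J] into [A] and [B]. A
    part with one direction gives a surplus by [expn_gap]. Otherwise apply
    [branching] to [A], and then to [B] at every point found: if all answers are
    parity classes, these are at least [#|A| * #|B| >= #|J|] classes, which was
    excluded; if some answer has a surplus, the growth of the other part costs
    at most the factor [#|J| ^ k], which the surplus was chosen to cover. *)
Lemma branching_step (n : nat) (J : {set 'I_n}) (C : nat) :
  (1 < #|J|)%N ->
  (forall A : {set 'I_n}, A \subset J -> (0 < #|A| < #|J|)%N ->
    (exists k, forall m, exists L, growth_at A k m L) /\
    ((1 < #|A|)%N -> forall C, exists K, branching A C K)) ->
  exists K, branching J C K.
Proof.
move=> J1 IH; pose small (A : {set 'I_n}) := (A \subset J) && (0 < #|A| < #|J|)%N.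
set a := #|J| in J1 *.
have [k hk] : exists k, forall A, small A -> forall m, exists L, growth_at A k m L.
  apply: (@uniform_bound _ (fun A k => small A -> forall m, exists L, growth_at A k m L)).
    move=> A p q pq h sA m; have [L g] := h sA m.
    by exists L; apply: growth_atW g.
  move=> A; case: (boolP (small A)) => [/andP[AJ A0]|/negP nA]; last by exists 0%N.
  by have [[k hk] _] := IH A AJ A0; exists k.
have [K1 hK1] : exists K, forall A, small A -> (1 < #|A|)%N -> branching A (C * a ^ k) K.
  apply: (@uniform_bound _ (fun A K => small A -> (1 < #|A|)%N -> branching A (C * a ^ k) K)).
    by move=> A p q pq h sA A1; apply: branchingW (h sA A1).
  move=> A; case: (boolP (small A)) => [/andP[AJ A0]|/negP nA]; last by exists 0%N.
  have [_ h] := IH A AJ A0; case: (boolP (1 < #|A|)%N) => [A1|/negP nA].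
    by have [K hK] := h A1 (C * a ^ k)%N; exists K.
  by exists 0%N.
have [K2 K20 hK2] := expn_gap k C J1.
have [L hL] : exists L, forall mA : 'I_(K1 + K2).+1 * {set 'I_n},
    small mA.2 -> growth_at mA.2 k mA.1 L.
  apply: (@uniform_bound _ (fun mA L => small mA.2 -> growth_at mA.2 k (val mA.1) L)).
    by move=> [m A] p q pq h sA; apply: growth_atW (h sA).
  move=> [m A]; case: (boolP (small A)) => [sA|/negP nA]; last by exists 0%N.
  by have [L g] := hk A sA m; exists L.
(* [E] bounds the distance of the points supplied by the growth of a part at the
   scales in use, and [R] leaves room for all base points and windows below. *)
pose E := (k * 2 ^ (K1 + K2))%N; pose R := (4 * (K1 + K2 + L + E))%N.
exists R.+1 => u h u0.
have [/asboolP hit|/asboolP nhit] := boolP `[< hits J R.+1 1 a u >]; first by left.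
right.
have [A [AJ A0 Apar]] := parity_constant (ltnW J1) u0 nhit.
have [hA hB] := harmonic_on_split AJ Apar h.
pose part A' := small A' /\ harmonic_on J A' R u.
have grow A' x m : part A' -> (m <= K1 + K2)%N -> box J (R - L) x -> u x != 0 ->
    hits A' E m (maxn 2 #|A'| ^ (m - k)) (fun y => u (x + y)).
  move=> [sA' hA'] mK bx ux; have /andP[A'J _] := sA'.
  have mK' : (m < (K1 + K2).+1)%N by [].
  apply: hitsW (hL (Ordinal mK', A') sA' (fun y => u (x + y)) _ _) => //=.
  - by rewrite leq_mul2l leq_exp2l // mK orbT.
  - by apply: (harmonic_on_translate A'J bx) hA'; rewrite subnK // /R; lia.
  - by rewrite addr0.
have branch A' x : part A' -> (1 < #|A'|)%N -> box J (R - K1) x -> u x != 0 ->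
    hits A' K1 1 #|A'| (fun y => u (x + y)) \/
    exists j, (0 < j <= K1)%N /\
      hits A' K1 j (C * a ^ k * #|A'| ^ j) (fun y => u (x + y)).
  move=> [sA' hA'] A'1 bx ux; have /andP[A'J _] := sA'.
  apply: (hK1 A' sA' A'1 (fun y => u (x + y))); last by rewrite addr0.
  by apply: (harmonic_on_translate A'J bx) hA'; rewrite subnK // /R; lia.
(* A surplus for one part at any base point gives one for [J]. *)
have gain A1 A2 j q : part A1 -> part A2 -> [disjoint A1 & A2] ->
    (#|A1| + #|A2| = a)%N -> (1 < #|A1|)%N -> (1 < #|A2|)%N -> (0 < j <= K1)%N ->
    box J K1 q -> hits A1 K1 j (C * a ^ k * #|A1| ^ j) (fun y => u (q + y)) ->
    exists j, (0 < j <= R.+1)%N /\ hits J R.+1 j (C * a ^ j) u.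
  move=> p1 p2 d12 sum12 A11 A21 /andP[j0 jK] bq hq; exists j; split.
    by rewrite j0 /R; lia.
  have [/andP[A1J _] _] := p1; have [/andP[A2J _] _] := p2.
  apply: (@hitsW _ J _ (K1 + (K1 + E)) _ _ _
    (C * a ^ k * #|A1| ^ j * maxn 2 #|A2| ^ (j - k))) => //.
  - by rewrite /R; lia.
  - rewrite (maxn_idPr A21) -!mulnA leq_mul2l; apply/orP; right.
    apply: leq_trans (_ : (#|A1| * #|A2|) ^ j <= _)%N.
      by rewrite leq_exp2r // -sum12; nia.
    rewrite expnMn mulnCA leq_mul2l; apply/orP; right.
    apply: leq_trans (_ : #|A2| ^ (k + (j - k)) <= _)%N.
      by rewrite leq_pexp2l ?(ltnW A21) //; lia.
    by rewrite expnD leq_mul //; case: (k) => // k'; rewrite leq_exp2r // -sum12 leq_addl.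
  apply: (hits_translate bq); apply: (hits_prod A1J A2J d12 hq) => x bx ux.
  have -> : (fun y => u (q + (x + y))) = (fun y => u (q + x + y)).
    by apply/funext => y; rewrite addrA.
  apply: grow => //; first by lia.
  apply: (@boxW _ J _ (K1 + K1)) => //; first by rewrite /R; lia.
  by apply: boxD => //; apply: boxW bx.
have lopsided A1 A2 : part A1 -> part A2 -> [disjoint A1 & A2] ->
    (#|A1| + #|A2| = a)%N -> #|A1| = 1%N ->
    exists j, (0 < j <= R.+1)%N /\ hits J R.+1 j (C * a ^ j) u.
  move=> p1 p2 d12 sum12 A11; exists K2; split; first by rewrite K20 /R; lia.
  have [/andP[A1J _] _] := p1; have [/andP[A2J _] _] := p2.
  apply: (@hitsW _ J _ (E + E) _ _ _
    (maxn 2 #|A1| ^ (K2 - k) * maxn 2 #|A2| ^ (K2 - k))) => //.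
  - by rewrite /R; lia.
  - by apply: leq_trans hK2 _; rewrite A11 -sum12 A11.
  apply: (hits_prod A1J A2J d12) => [|x bx ux].
    have -> : u = (fun y => u (0 + y)) by apply/funext => y; rewrite add0r.
    by apply: grow => //; [lia|exact: box0].
  apply: grow => //; first by lia.
  by apply: boxW bx => //; rewrite /R; lia.
pose B := J :\: A.
have cardB : (#|A| + #|B| = a)%N by rewrite cardsD (finset.setIidPr AJ) subnKC ?subset_leq_card.
have dAB : [disjoint A & B] by rewrite -finset.setI_eq0 finset.setIDA finset.setDIl finset.setDv finset.set0I.
have pA : part A by split=> //; apply/andP.
have pB : part B by split=> //; rewrite /small finset.subsetDl; lia.
have [A1|A1] := eqVneq #|A| 1%N; first exact: (lopsided A B).
have [B1|B1] := eqVneq #|B| 1%N.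
  by apply: (lopsided B A); rewrite 1?disjoint_sym 1?addnC.
have A2 : (1 < #|A|)%N by lia.
have B2 : (1 < #|B|)%N by lia.
have uE : (fun y => u (0 + y)) = u by apply/funext => y; rewrite add0r.
have [] := branch A 0 pA A2 (box0 _ _) u0; last first.
  by move=> [j [jK hj]]; apply: (gain A B j 0) => //; apply: box0.
rewrite uE => hitA.
have [[q [j [bq jK hj]]]|none] := pselect (exists q j, [/\ box A K1 q, (0 < j <= K1)%N &
    hits B K1 j (C * a ^ k * #|B| ^ j) (fun y => u (q + y))]).
  apply: (gain B A j q) => //; rewrite 1?disjoint_sym 1?addnC //.
  exact: boxW bq.
case: nhit; apply: (@hitsW _ J _ (K1 + K1) _ _ _ (#|A| * #|B|)) => //.
- by rewrite /R; lia.
- by rewrite -/a -cardB; nia.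
apply: (hits_prod AJ (finset.subsetDl _ _) dAB hitA) => q bq uq.
have [] // := branch B q pB B2 _ uq.
  by apply: boxW bq => //; rewrite /R; lia.
by move=> [j [jK hj]]; case: none; exists q, j.
Qed.

Lemma growth (n : nat) (J : {set 'I_n}) : (0 < #|J|)%N ->
  (exists k, forall m, exists L, growth_at J k m L) /\
  ((1 < #|J|)%N -> forall C, exists K, branching J C K).
Proof.
move: {2}#|J| (erefl #|J|) => a; elim/ltn_ind: a J => a IH J Ja J0.
have br : (1 < #|J|)%N -> forall C, exists K, branching J C K.
  move=> J1 C; apply: branching_step => // A AJ /andP[A0 AltJ].
  by apply: (IH #|A|) => //; rewrite -Ja.
split=> //; have [J1|J1] := leqP #|J| 1; last first.
  have [K hK] := br J1 1%N; exists K.+1.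
  by apply: growth_of_branching => //; apply: branchingW hK.
have /eqP/cards1P[i ->] : #|J| = 1%N by lia.
exists 1%N => m; exists (2 ^ m)%N => u h u0; rewrite cards1 mul1n.
exact: hits_single.
Qed.

(** * Counting in cubes *)

Lemma hits_supp_count (R : realType) (n : nat) (J : {set 'I_n}) (q m M : nat)
    (r : R) u :
  q%:R <= r -> hits J q m M u -> (M <= supp_count r u)%N.
Proof.
move=> qr [s [us sz hs _]]; apply: leq_trans sz _.
rewrite /supp_count -(undup_id us) -(size_seq_fset tt).
apply/fsubset_leq_card/fsubsetP => x; rewrite seq_fsetE => /hs[bx ux].
rewrite in_fset_set; last exact/finite_setIr/finite_cube.
apply/mem_set; split=> // i; rewrite in_itv /= -ler_norml -intr_norm.
apply: le_trans qr; rewrite -[q%:R]/((q%:Z)%:~R) ler_int -abszE lez_nat.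
by apply: leq_trans (bx i) _; rewrite -[leqRHS]mul1n leq_mul2r leq_b1 orbT.
Qed.

Lemma N_growth (R : realType) (n : nat) : (1 <= n)%N ->
  exists k, (0 < k)%N /\ forall (m : nat) (r : R),
    (k * 2 ^ m)%:R <= r -> (n ^ (m - k) <= N n r)%N.
Proof.
move=> n1; have cT : #|finset.setT : {set 'I_n}| = n by rewrite cardsT card_ord.
have [|[k hk] _] := @growth n finset.setT; first by rewrite cT.
exists k.+1; split=> // m r kr; rewrite /N; case: ex_minnP => M /asboolP.
move=> [u [hu u0 <-]] _; have [L g] := hk m.
have {g}/(_ u) g := growth_atW (leqnSn k) (leqnn L) g.
apply: (hits_supp_count kr).
apply: hitsW (g _ _) => //; last by rewrite u0.
  case: (m - k.+1)%N => // d; rewrite leq_exp2r // cT.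
  exact: leq_maxr.
move=> x _; rewrite -[RHS](hu x); apply: eq_bigl => i.
by rewrite finset.in_setT.
Qed.

Lemma N_gt0 (R : realType) (n : nat) (r : R) : 0 <= r -> (0 < N n r)%N.
Proof.
move=> r0; rewrite /N; case: ex_minnP => M /asboolP[u [_ u0 <-]] _.
apply: (@hits_supp_count R n finset.setT 0 0) => //.
by apply: hits_pt; rewrite u0.
Qed.

Unset Implicit Arguments.

Theorem theorem3p1 (R : realType) (n : nat) (hn : (1 <= n)%N) :
  exists C : R, 0 < C /\
    forall r : R, 0 < r -> C * r `^ (log2 (n%:R : R)) <= (N n r)%:R.
Proof.
have [k [k0 hk]] := @N_growth R n hn.
set e := log2 (n%:R : R).
have n0 : 0 < n%:R :> R by rewrite ltr0n.
have e0 : 0 <= e by rewrite /e /log2 divr_ge0 // ln_ge0 // ler1n.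
have pow2e : (2 : R) `^ e = n%:R.
  rewrite /e /log2 /powR pnatr_eq0 /= divfK ?lnK ?posrE //.
  by rewrite gt_eqF // ln_gt0 // ltr1n.
pose D : R := k%:R `^ e * n%:R ^+ k.+1.
have D0 : 0 < D by rewrite mulr_gt0 ?powR_gt0 ?exprn_gt0 ?ltr0n.
exists D^-1; split; first by rewrite invr_gt0.
move=> r r0.
(* [m] is the largest scale with [k * 2 ^ m <= r], or 0 if there is none; in the
   latter case the bound only asks for the origin. *)
have [m [rm Nm]] : exists m : nat, r <= (k * 2 ^ m.+1)%:R /\ (n ^ (m - k) <= N n r)%N.
  pose q := Num.truncn r; pose m := trunc_log 2 (q %/ k).
  have /andP[qr rq] := truncn_itv (ltW r0).
  exists m; split.
    apply: le_trans (ltW rq) _; rewrite ler_nat -/q.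
    have := trunc_log_ltn (q %/ k) (isT : (1 < 2)%N).
    by rewrite ltn_divLR // mulnC.
  have [qk|kq] := ltnP q k.
    by rewrite /m divn_small //= trunc_log0 sub0n expn0 N_gt0 // ltW.
  apply: hk; apply: le_trans qr; rewrite ler_nat mulnC -leq_divRL //.
  by apply: trunc_logP => //; rewrite divn_gt0.
rewrite mulrC ler_pdivrMr // mulrC.
apply: (@le_trans _ _ (k%:R `^ e * n%:R ^+ m.+1)).
  apply: le_trans (ge0_ler_powR e0 _ _ rm) _; rewrite ?nnegrE ?ler0n ?(ltW r0) //.
  rewrite natrM powRM ?ler0n //.
  have -> : (2 ^ m.+1)%:R `^ e = n%:R ^+ m.+1 :> R; last by [].
  have -> : (2 ^ m.+1)%:R = 2 `^ m.+1%:R :> R by rewrite powR_mulrn // natrX.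
  by rewrite -powRrM (mulrC _ e) powRrM pow2e powR_mulrn.
rewrite /D -mulrA ler_pM2l ?powR_gt0 ?ltr0n //.
apply: (@le_trans _ _ (n%:R ^+ k.+1 * (n ^ (m - k))%:R)).
  by rewrite -!natrX -natrM ler_nat -expnD leq_pexp2l //; lia.
by rewrite ler_pM2l ?exprn_gt0 // ler_nat.
Qed.
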